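(* Let $k,n$ be integers with $k\geq 2$ and $n-k\geq 2$. Let $t_1,\dotsc,t_{n-1}\in\mathbb{C}$ be distinct points such that the set $\{t_1,\dotsc,t_{n-1}\}$ is stable under complex conjugation, exactly $r_\square$ of the $t_i$ being real. Let $f(t)=\prod_{i=1}^{n-1}(t-t_i)$ and let $r$ be the number of real roots of $f'(t)$. Then the number of real solutions to the real osculating instance of the Schubert problem $(\lambda(k,n),\square^{n-1})$ of osculation type $r_\square$ given by these points, that is, the number of real points in the intersection $$X_{\square}(t_1)\,\cap\,X_{\square}(t_2)\,\cap\,\dotsb\,\cap\,X_{\square}(t_{n-1})\,\cap\,X_{\lambda(k,n)}(\infty)$$ in $\mathrm{Gr}(k,n)$, is $\nu(k,n,r)$.
   Context: $\mathrm{Gr}(k,n)$ is the Grassmannian of $k$-dimensional complex linear subspaces of $\mathbb{C}^n$; a point $H\in \mathrm{Gr}(k,n)$ is real if it is equal to its complex conjugate $\overline{H}$. Let $\gamma(t)=(1,t,\tfrac{t^2}{2},\tfrac{t^3}{3!},\dotsc,\tfrac{t^{n-1}}{(n-1)!})\in\mathbb{C}^n$. For $t\in\mathbb{C}$, the osculating flag $F_\bullet(t)$ has $i$-dimensional subspace $F_i(t)=\mathrm{span}\{\gamma(t),\gamma'(t),\dotsc,\gamma^{(i-1)}(t)\}$, and $F_\bullet(\infty)$ has $F_i(\infty)=\mathrm{span}\{e_{n+1-i},\dotsc,e_n\}$, where $e_1,\dotsc,e_n$ is the standard basis. For a partition $\lambda$ with $n-k\geq\lambda_1\geq\dotsb\geq\lambda_k\geq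 0$ and $t\in\mathbb{P}^1=\mathbb{C}\cup\{\infty\}$, the Schubert variety is $$X_\lambda(t)=\{H\in\mathrm{Gr}(k,n)\mid \dim H\cap F_{n-k+i-\lambda_i}(t)\geq i\ \text{ for } i=1,\dotsc,k\}.$$ $\square$ denotes the partition $(1,0,\dotsc,0)$, so $X_\square(t)=\{H\mid H\cap F_{n-k}(t)\neq 0\}$. $\lambda(k,n)$ denotes the partition $((n-k-1)^{k-1},0)$ (the part $n-k-1$ repeated $k-1$ times, followed by $0$), so $X_{\lambda(k,n)}(\infty)=\{H\mid \dim H\cap F_{i+1}(\infty)\geq i,\ i=1,\dotsc,k-1\}$. The Schubert problem $(\lambda(k,n),\square^{n-1})$ is the list consisting of $\lambda(k,n)$ and $n-1$ copies of $\square$. The number $\nu(k,n,r)$ is the coefficient of $x^{n-k-1}y^{k-1}$ in $(x+y)^r(x^2+y^2)^c$, where $c=\frac{n-2-r}{2}$ (when $r$ is the number of real roots of $f'(t)$, which has degree $n-2$, $c$ is the number of irreducible real quadratic factors of $f'(t)$).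
   Formalization: The formal theorem adds the assumption that f'(t) has no repeated roots; without it the claim fails, e.g. k=2, n=4, f=t^3-1 has one real solution, while ν(2,4,2)=2. *)

(* Defs.v *)
From mathcomp Require Import all_boot all_order all_algebra all_field.
From mathcomp Require Import boolp classical_sets cardinality reals.
From mathcomp Require Export complex.

Import Order.TTheory GRing.Theory Num.Theory.

Local Open Scope classical_set_scope.
Local Open Scope ring_scope.

(* Points of P^1(C) = C u {oo}: [Some t] is the finite point t, [None] is oo. *)
Definition P1 (C : Type) : Type := option C.


(* Vectors of C^n are row vectors, with coordinates numbered from 0. *)
Definition gamma_coord (C : numClosedFieldType) (j : nat) : {poly C} :=
  (j`!)%:R^-1 *: 'X^j.

(* The m-th derivative of gamma(t) = (1, t, t^2/2, ..., t^(n-1)/(n-1)!). *)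
Definition gamma_deriv {C : numClosedFieldType} (n m : nat) (t : C) : 'rV[C]_n :=
  \row_(j < n) ((gamma_coord C j)^`(m)).[t].

(* F_i(t), for i <= n. Since coordinates are numbered from 0, the vectors
   e_(n+1-i), ..., e_n are the [delta_mx ord0 j] with n - i <= j. *)
Definition osc_flag {C : numClosedFieldType} (n : nat) (p : P1 C) (i : nat) :
    {vspace 'rV[C]_n} :=
  match p with
  | Some t => <<[seq gamma_deriv n m t | m <- iota 0 i]>>%VS
  | None => <<[seq delta_mx ord0 j | j : 'I_n <- enum 'I_n & (n - i <= j)%N]>>%VS
  end.

Definition Gr {C : numClosedFieldType} (k n : nat) : set {vspace 'rV[C]_n} :=
  [set H | \dim H = k].

(* [la i] is the part lambda_(i+1), for i : 'I_k. *)
Definition schubert {C : numClosedFieldType} {k : nat} (n : nat) (la : 'I_k -> nat)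
    (p : P1 C) : set {vspace 'rV[C]_n} :=
  [set H | Gr k n H /\
     forall i : 'I_k,
       (i.+1 <= \dim (H :&: osc_flag n p (n - k + i.+1 - la i)))%N].

Definition box (k : nat) : 'I_k -> nat :=
  fun i => if val i == 0%N then 1%N else 0%N.

Definition lambda_kn (k n : nat) : 'I_k -> nat :=
  fun i => if (i.+1 < k)%N then (n - k - 1)%N else 0%N.

Definition osc_instance {C : numClosedFieldType} (k n : nat) (ts : seq C) :
    set {vspace 'rV[C]_n} :=
  (\bigcap_(t in [set` ts]) schubert n (box k) (Some t))
    `&` schubert n (lambda_kn k n) None.

Definition real_subspace {C : numClosedFieldType} {n : nat}
    (H : {vspace 'rV[C]_n}) : Prop :=
  [set map_mx Num.conj v | v in [set` H]] = [set` H].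

(* Polynomials in x and y are encoded in {poly {poly nat}}, the outer variable
   being y and the inner one x. *)
Definition nu (k n r : nat) : nat :=
  let x : {poly {poly nat}} := 'X%:P in
  let y : {poly {poly nat}} := 'X in
  let c := ((n - 2 - r)./2)%N in
  let p : {poly {poly nat}} := (x + y) ^+ r * (x ^+ 2 + y ^+ 2) ^+ c in
  let q : {poly nat} := p`_(k - 1)%N in
  (q`_(n - k - 1)%N)%R.

(* Main.v *)
Require Import Defs.
From HB Require Import structures.
From mathcomp Require Import all_boot all_order all_algebra all_field.
From mathcomp Require Import ring zify.
From mathcomp Require Import boolp classical_sets cardinality reals.

Set Implicit Arguments.
Unset Strict Implicit.
Unset Printing Implicit Defensive.

Import Order.TTheory GRing.Theory Num.Theory.
Local Open Scope classical_set_scope.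
Local Open Scope card_scope.
Local Open Scope ring_scope.

(** A vector v of C^n is read as the polynomial
    p_v = \sum_m v_m (-X)^(n-1-m) / (n-1-m)! of degree less than n.  Under this
    dictionary both kinds of osculating subspace become transparent: F_i(t) is
    the space of polynomials divisible by (X - t)^(n-i)
    ([mem_osc_flag_fin]) and F_i(oo) is the space of polynomials of degree less
    than i ([mem_osc_flag_inf]).  A solution of the Schubert problem is then a
    k-dimensional space H of polynomials that contains at least k - 1
    dimensions of polynomials of degree less than k and, for every t_i, a
    nonzero polynomial vanishing at t_i to order k
    ([schubert_lambda_kn], [schubert_box]).

    The key tool is the bilinear concomitant of the k-th derivative,
    L(p, h) = \sum_(i < k) (-1)^i p^(i) h^(k-1-i),
    whose derivative telescopes to p h^(k) - (-1)^k p^(k) h.  When h has degree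
    less than k this is a multiple of p^(k) h ([deriv_concomitant_small]); in
    particular L(p, h) is constant if both degrees are less than k, and this
    defines a nondegenerate pairing on polynomials of degree less than k.

    Let H be a solution and W its part of degree less than k, which has
    dimension k - 1.  Some nonzero h of degree less than k pairs to zero with
    W ([annihilator_exists]), so L(-, h) has rank one on H, and its image is
    spanned by a polynomial of degree less than n which vanishes at
    every t_i, that is, by f.  Differentiating L(p, h) = c f shows that f' is a
    multiple of p^(k) h; by degrees, h has degree k - 1.  Hence h divides f' and
    H = {p | L(p, h) is a multiple of f} ([solution_is_solspace]).  Conversely,
    for every divisor h of f' of degree k - 1 this space is a solution: a k-fold
    antiderivative of a multiple of f' / h, corrected by a constant, gives p
    with L(p, h) = f ([solspace_top]), from which the dimension and the
    incidence conditions follow ([dim_solspace], [solspace_meets]).  So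
    solutions correspond to monic divisors h of f' of degree k - 1, and as f is
    real, real solutions correspond to real divisors ([real_solspace]).

    Finally f' is a product of r linear and c irreducible quadratic real
    factors, distinct by separability, and a real divisor is the product of a
    subset of them ([real_divisorP]).  Choosing y^d for each factor of degree d
    that is taken and x^d for each one left out, the number of subsets of total
    degree k - 1 is the coefficient of x^(n-k-1) y^(k-1) in
    (x + y)^r (x^2 + y^2)^c ([nu_subsets]). *)

(** * Linear algebra *)

Lemma span_ind (K : fieldType) (vT : vectType K) (P : vT -> Prop) (X : seq vT) :
  P 0 -> (forall a u w, P u -> P w -> P (a *: u + w)) ->
  {in X, forall u, P u} -> forall v, v \in <<X>>%VS -> P v.
Proof.
move=> P0 Plin PX v /(coord_span (X := in_tuple X)) ->.
elim/big_rec: _ => // i w _ Pw; apply: Plin => //.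
by apply: PX; apply: mem_nth.
Qed.

(** The modular law: enlarging U by V enlarges its intersection with H by at
    most the dimension of V. Every incidence condition below that is implied by
    another one follows from this. *)
Lemma dim_cap_addv (K : fieldType) (vT : vectType K) (H U V : {vspace vT}) :
  (\dim (H :&: (U + V)) <= \dim (H :&: U) + \dim V)%N.
Proof.
set A := (H :&: (U + V))%VS.
have := dimv_sum_cap A U; have := dimv_add_leqif U V => -[leUV _].
have : (\dim (A + U) <= \dim (U + V))%N.
  by apply: dimvS; rewrite subv_add addvSl /A capvSr.
have : (\dim (A :&: U) <= \dim (H :&: U))%N.
  by apply: dimvS; rewrite /A capvS // capvSl.
lia.
Qed.

Lemma dim_addv_line (K : fieldType) (vT : vectType K)
    (U : {vspace vT}) (v : vT) :
  v \notin U -> \dim (U + <[v]>)%VS = (\dim U).+1.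
Proof.
move=> vU; have v0 : v != 0 by apply: contraNneq vU => ->; rewrite mem0v.
rewrite dimv_disjoint_sum ?dim_vline ?v0 ?addn1 //.
apply/eqP; rewrite -subv0; apply/subvP => w /memv_capP[wU /vlineP[a Ew]].
rewrite memv0 Ew; have [->|a0] := eqVneq a 0; first by rewrite scale0r.
by have := memvZ a^-1 wU; rewrite Ew scalerA mulVf // scale1r (negPf vU).
Qed.

Lemma lin_ker_neq0 (K : fieldType) (aT rT : vectType K)
    (phi : {linear aT -> rT}) :
  (\dim {:rT} < \dim {:aT})%N -> exists2 u, u != 0 & phi u = 0.
Proof.
move=> ltd; pose U := lker (linfun phi).
have U0 : vpick U != 0.
  rewrite vpick0 -dimv_eq0 -lt0n /U -[lker _]capfv.
  have := limg_ker_dim (linfun phi) fullv.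
  have := dimvS (subvf (limg (linfun phi))).
  lia.
by exists (vpick U) => //; have := memv_pick U; rewrite memv_ker lfunE => /eqP.
Qed.

(** * Vectors as polynomials, and osculating flags *)

Section VectorsAsPolynomials.
Variables (C : numClosedFieldType) (n : nat).
Implicit Types (v : 'rV[C]_n) (p : {poly C}).

(** The entry of gamma^(i)(t) at position m is t^(m-i) / (m-i)!, so the weights
    1 / (n-1-m)! make the binomial theorem turn this vector into a multiple of
    (t - X)^(n-1-i). *)
Definition vpoly v : {poly C} :=
  \sum_(m < n) v 0 m *: (((n - m.+1)`!)%:R^-1 *: (- 'X) ^+ (n - m.+1)).

Lemma vpoly_is_linear : linear vpoly.
Proof.
move=> a u v; rewrite /vpoly scaler_sumr -big_split /=.
by apply: eq_bigr => m _; rewrite !mxE scalerDl !scalerA.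
Qed.

HB.instance Definition _ :=
  GRing.isLinear.Build C 'rV[C]_n {poly C} _ vpoly vpoly_is_linear.

Lemma factC_neq0 m : (m`!)%:R != 0 :> C.
Proof. by rewrite pnatr_eq0 -lt0n fact_gt0. Qed.

Lemma expNX m : (- 'X : {poly C}) ^+ m = (-1) ^+ m *: 'X^m.
Proof. by rewrite -scaleN1r exprZn. Qed.

Lemma coef_vpoly v (m : 'I_n) :
  (vpoly v)`_(n - m.+1) = v 0 m * (((n - m.+1)`!)%:R^-1 * (-1) ^+ (n - m.+1)).
Proof.
rewrite /vpoly coef_sum (bigD1 m) //= big1 ?addr0 => [|j neq_jm];
  rewrite !coefZ expNX coefZ coefXn ?eqxx ?mulr1 //.
case: eqP => [eq_jm|]; last by rewrite !mulr0.
case/eqP: neq_jm; apply: val_inj => /=.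
by have := ltn_ord j; have := ltn_ord m; lia.
Qed.

Lemma size_vpoly v : (size (vpoly v) <= n)%N.
Proof.
apply/leq_sizeP => j le_nj; rewrite /vpoly coef_sum big1 // => m _.
rewrite !coefZ expNX coefZ coefXn; case: eqP; rewrite ?mulr0 //.
by have := ltn_ord m; lia.
Qed.

Lemma vpoly_inj : injective vpoly.
Proof.
apply: raddf_inj => v v0; apply/rowP => m.
have := coef_vpoly v m; rewrite v0 coef0 => /esym/eqP; rewrite !mulf_eq0.
by rewrite invr_eq0 (negPf (factC_neq0 _)) signr_eq0 !orbF mxE => /eqP.
Qed.

Lemma vpoly_eq0 v : (vpoly v == 0) = (v == 0).
Proof. by rewrite -(inj_eq vpoly_inj) linear0. Qed.

Lemma vpolyP p : (size p <= n)%N -> {v | vpoly v = p}.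
Proof.
move=> lepn.
exists (\row_m (p`_(n - m.+1) * ((n - m.+1)`!)%:R * (-1) ^+ (n - m.+1))).
apply/polyP => j; case: (ltnP j n) => [ltjn | lenj]; last first.
  by rewrite !nth_default ?(leq_trans _ lenj) // size_vpoly.
have lt_rev : (n - j.+1 < n)%N by lia.
have -> : j = (n - (Ordinal lt_rev).+1)%N by rewrite /=; lia.
rewrite coef_vpoly mxE mulrACA mulfK ?factC_neq0 //.
by rewrite -expr2 sqrr_sign mulr1.
Qed.

Lemma vpoly_conj v : vpoly (map_mx Num.conj v) = map_poly Num.conj (vpoly v).
Proof.
rewrite /vpoly rmorph_sum; apply: eq_bigr => m _ /=.
rewrite mxE !map_polyZ /= rmorphXn rmorphN /= map_polyX.
by rewrite fmorphV rmorph_nat.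
Qed.

Lemma derivn_gamma_coord (m j : nat) (t : C) : (m <= j)%N ->
  ((gamma_coord C j)^`(m)).[t] = ((j - m)`!)%:R^-1 * t ^+ (j - m).
Proof.
move=> lemj; rewrite /gamma_coord derivnZ derivnXn hornerZ hornerMn hornerXn.
rewrite -[_ *+ (_ ^_ _)]mulr_natl mulrA; congr (_ * _).
rewrite -(ffact_fact lemj) natrM invfM mulrAC mulVf ?mul1r //.
by rewrite pnatr_eq0 -lt0n ffact_gt0.
Qed.

Lemma derivn_gamma_coord0 (m j : nat) (t : C) : (j < m)%N ->
  ((gamma_coord C j)^`(m)).[t] = 0.
Proof.
move=> ltjm; rewrite /gamma_coord derivnZ derivnXn ffact_small //.
by rewrite mulr0n scaler0 horner0.
Qed.

Lemma coef_CsubXn (t : C) (N i : nat) :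
  ((t%:P - 'X) ^+ N)`_i = (t ^+ (N - i) * (-1) ^+ i) *+ 'C(N, i).
Proof.
rewrite exprDn coef_sum.
have E (j : 'I_N.+1) : (t%:P ^+ (N - j) * (- 'X) ^+ j *+ 'C(N, j))`_i =
    if (j : nat) == i then (t ^+ (N - i) * (-1) ^+ i) *+ 'C(N, i) else 0.
  rewrite coefMn expNX -scalerAr coefZ -rmorphXn coefCM coefXn eq_sym.
  by case: eqP => [->|_]; rewrite ?mulr0 ?mul0rn // mulr1 mulrC.
rewrite (eq_bigr _ (fun j _ => E j)) -big_mkcond /=.
case: (ltnP i N.+1) => [ltiN|ltNi].
  by rewrite (big_pred1 (Ordinal ltiN)) // => j; rewrite -val_eqE.
rewrite big_pred0 ?bin_small // => j; apply/eqP => eqji.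
by have := ltn_ord j; lia.
Qed.

Lemma vpoly_gamma_deriv (m : nat) (t : C) : (m < n)%N ->
  vpoly (gamma_deriv n m t) =
  ((n - m.+1)`!)%:R^-1 *: (t%:P - 'X) ^+ (n - m.+1).
Proof.
move=> ltmn; set N := (n - m.+1)%N.
apply/polyP => i; case: (ltnP i n) => [ltin | leni]; last first.
  rewrite nth_default ?(leq_trans (size_vpoly _)) // coefZ coef_CsubXn.
  by rewrite bin_small ?mulr0n ?mulr0 // /N; lia.
have lt_rev : (n - i.+1 < n)%N by lia.
have Ei : i = (n - (Ordinal lt_rev).+1)%N by rewrite /=; lia.
rewrite {1}Ei coef_vpoly mxE /= coefZ coef_CsubXn -/N -Ei.
case: (leqP i N) => [leiN | ltNi]; last first.
  rewrite bin_small // mulr0n mulr0 derivn_gamma_coord0 ?mul0r //.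
  by move: ltNi; rewrite /N; lia.
rewrite derivn_gamma_coord; last by move: leiN; rewrite /N; lia.
have -> : (n - i.+1 - m = N - i)%N by rewrite /N; lia.
rewrite -mulr_natr -(bin_fact leiN) !natrM !invfM.
have := factC_neq0 i; have := factC_neq0 (N - i).
have : ('C(N, i))%:R != 0 :> C by rewrite pnatr_eq0 -lt0n bin_gt0.
by move=> h1 h2 h3; field; rewrite h1 h2 h3.
Qed.

Lemma XsubC_expansion p (t : C) :
  exists c : nat -> C, p = \sum_(j < size p) c j *: ('X - t%:P) ^+ j.
Proof.
exists (fun j => (p \Po ('X + t%:P))`_j).
by rewrite -{1}(comp_polyXaddC_K p t) comp_polyE size_comp_poly2 ?size_XaddC.
Qed.

Lemma vpoly_gamma_deriv_XsubC (m : nat) (t : C) : (m < n)%N ->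
  {c : C | c != 0 &
    vpoly (gamma_deriv n m t) = c *: ('X - t%:P) ^+ (n - m.+1)}.
Proof.
move=> ltmn; exists (((n - m.+1)`!)%:R^-1 * (-1) ^+ (n - m.+1)).
  by rewrite mulf_neq0 ?signr_eq0 // invr_eq0 factC_neq0.
by rewrite vpoly_gamma_deriv // -opprB -scaleN1r exprZn scalerA.
Qed.

(** The generators of F_i(t) become multiples of the powers (X - t)^e with n-i
    <= e < n; these form a basis of the multiples of (X - t)^(n-i) of degree
    less than n, by Taylor expansion at t of the cofactor. *)
Lemma mem_osc_flag_fin (t : C) (i : nat) v : (i <= n)%N ->
  (v \in osc_flag n (Some t) i) = (('X - t%:P) ^+ (n - i) %| vpoly v).
Proof.
move=> lein; apply/idP/idP => [|/dvdpP[q Eq]].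
  move: v; apply: span_ind => [|a u w|u /mapP[m]].
  - by rewrite linear0 dvdp0.
  - move=> dv_u dv_w; rewrite linearP /= dvdp_add // -mul_polyC.
    by rewrite dvdp_mull.
  - rewrite mem_iota add0n => /andP[_ ltmi] ->.
    have [c _ ->] := vpoly_gamma_deriv_XsubC t (leq_trans ltmi lein).
    rewrite -mul_polyC dvdp_mull // dvdp_exp2l //; lia.
have szq : (size q <= i)%N.
  have [->|q0] := eqVneq q 0; first by rewrite size_poly0.
  have := size_vpoly v; rewrite Eq size_Mmonic ?monic_exp ?monicXsubC //.
  rewrite size_exp_XsubC.
  by move: lein; clear; move: (size q) => s; rewrite addnS /=; lia.
have [c Eqc] := XsubC_expansion q t.
have {Eqc}: vpoly v = \sum_(j < size q) c j *: ('X - t%:P) ^+ (n - i + j).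
  rewrite Eq {1}Eqc mulr_suml; apply: eq_bigr => j _.
  by rewrite -scalerAl -exprD addnC.
have term (j : 'I_(size q)) : {u | u \in osc_flag n (Some t) i &
    vpoly u = c j *: ('X - t%:P) ^+ (n - i + j)}.
  have ltji : (j < i)%N := leq_trans (ltn_ord j) szq.
  have ltn' : (i - j.+1 < n)%N by lia.
  have [d d0 Ed] := vpoly_gamma_deriv_XsubC t ltn'.
  exists ((c j / d) *: gamma_deriv n (i - j.+1) t).
    apply: memvZ; apply: memv_span; apply/mapP; exists (i - j.+1)%N => //.
    by rewrite mem_iota; lia.
  rewrite linearZ /= Ed scalerA divfK //; congr (_ *: _ ^+ _).
  by move: lein ltji; clear; move: (nat_of_ord j) => l; lia.
move=> Ev; have: vpoly v = vpoly (\sum_(j < size q) s2val (term j)).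
  by rewrite Ev linear_sum; apply: eq_bigr => j _; case: (term j).
move/vpoly_inj ->; rewrite memv_suml // => j _.
by case: (term j).
Qed.

Lemma mem_osc_flag_inf (i : nat) v : (i <= n)%N ->
  (v \in osc_flag n None i) = (size (vpoly v) <= i)%N.
Proof.
move=> lein; apply/idP/idP => [|szv].
  move: v; apply: span_ind => [|a u w su sw|u /mapP[m]].
  - by rewrite linear0 size_poly0.
  - rewrite linearP /= (leq_trans (size_polyD _ _)) // geq_max sw andbT.
    exact: leq_trans (size_scale_leq _ _) su.
  - rewrite mem_filter => /andP[lenim _] ->; apply/leq_sizeP => j leij.
    case: (ltnP j n) => [ltjn | lenj]; last first.
      by rewrite nth_default // (leq_trans (size_vpoly _)).
    have lt_rev : (n - j.+1 < n)%N by lia.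
    have -> : j = (n - (Ordinal lt_rev).+1)%N by rewrite /=; lia.
    rewrite coef_vpoly mxE eqxx /= -val_eqE /=.
    by case: eqP => [|_]; rewrite ?mul0r //; lia.
rewrite [v]row_sum_delta memv_suml // => m _.
case: (leqP (n - i) m) => [lem | ltm].
  apply: memvZ; apply: memv_span; apply/mapP; exists m => //.
  by rewrite mem_filter lem mem_enum.
have := coef_vpoly v m; rewrite nth_default; last by apply: leq_trans szv _; lia.
move/esym/eqP; rewrite !mulf_eq0 invr_eq0 (negPf (factC_neq0 _)) signr_eq0 !orbF.
by move=> /eqP->; rewrite scale0r mem0v.
Qed.

(** * The Schubert conditions *)

(** All that the dimension counts use of a flag: each step adds at most one
    dimension. *)
Lemma osc_flag_ext (p : P1 C) (i j : nat) : (i <= j <= n)%N ->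
  exists2 V : {vspace 'rV[C]_n}, (\dim V <= j - i)%N &
    osc_flag n p j = (osc_flag n p i + V)%VS.
Proof.
case/andP=> leij lejn; case: p => [t|] /=.
  exists <<[seq gamma_deriv n m t | m <- iota i (j - i)]>>%VS.
    by rewrite (leq_trans (dim_span _)) // size_map size_iota.
  by rewrite -{1}(subnKC leij) iotaD map_cat span_cat.
pose L : seq 'I_n := pmap insub (iota (n - j) (j - i)).
exists <<[seq delta_mx ord0 l | l <- L]>>%VS.
  rewrite (leq_trans (dim_span _)) // size_map size_pmap_sub.
  by rewrite (leq_trans (count_size _ _)) // size_iota.
rewrite -span_cat; apply: eq_span => v; rewrite mem_cat.
apply/mapP/orP => [[l]|[]/mapP[l]]; rewrite ?mem_filter ?mem_pmap_sub ?mem_iota /=.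
- case/andP=> lel _ ->; case: (leqP (n - i) l) => [le'l | lt'l].
    by left; apply/mapP; exists l; rewrite // mem_filter le'l mem_enum.
  by right; apply/mapP; exists l; rewrite // mem_pmap_sub mem_iota /=; lia.
- case/andP=> lel _ ->; exists l; rewrite // mem_filter mem_enum andbT; lia.
- case/andP=> lel _ ->; exists l; rewrite // mem_filter mem_enum andbT; lia.
Qed.

Lemma osc_flag_full (p : P1 C) : osc_flag n p n = fullv.
Proof.
apply/eqP; rewrite eqEsubv subvf; apply/subvP => v _; case: p => [t|].
  by rewrite mem_osc_flag_fin // subnn expr0 dvd1p.
by rewrite mem_osc_flag_inf // size_vpoly.
Qed.

Lemma dim_cap_osc_flag (H : {vspace 'rV[C]_n}) (p : P1 C) (i j : nat) :
  (i <= j <= n)%N ->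
  (\dim (H :&: osc_flag n p j) <= \dim (H :&: osc_flag n p i) + (j - i))%N.
Proof.
move=> leijn; have [V dimV ->] := osc_flag_ext p leijn.
by rewrite (leq_trans (dim_cap_addv _ _ _)) // leq_add2l.
Qed.

Lemma dim_osc_flag_inf (i : nat) : (i <= n)%N ->
  \dim (osc_flag n (None : P1 C) i) = i.
Proof.
move=> lein.
have F0 : \dim (osc_flag n (None : P1 C) 0) = 0%N.
  apply/eqP; rewrite dimv_eq0 -subv0; apply/subvP => v.
  by rewrite mem_osc_flag_inf // leqn0 size_poly_eq0 vpoly_eq0 memv0.
have := @dim_cap_osc_flag fullv None i n; rewrite lein leqnn => /(_ isT).
have := @dim_cap_osc_flag fullv None 0 i; rewrite leq0n lein => /(_ isT).
rewrite osc_flag_full !capfv F0 dimvf /dim /= mul1n; lia.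
Qed.

(** Only the first condition is a restriction: the others ask for intersections
    with subspaces of such a small codimension that they hold for every H. *)
Lemma schubert_box (k : nat) (t : C) (H : {vspace 'rV[C]_n}) :
  (0 < k < n)%N ->
  schubert n (box k) (Some t) H <->
  Gr k n H /\ (H :&: osc_flag n (Some t) (n - k) != 0)%VS.
Proof.
case/andP=> k_gt0 ltkn.
split=> [[dimH cond]|[dimH meet]]; [split=> // | split=> // i].
  have := cond (Ordinal k_gt0); rewrite /box /= addnK.
  by apply: contraTneq => ->; rewrite dimv0.
rewrite /box; case: eqP => [->|/eqP i0]; first by rewrite addnK lt0n dimv_eq0.
have ltik := ltn_ord i.
have := @dim_cap_osc_flag H (Some t) (n - k + i.+1 - 0) n.
rewrite osc_flag_full capvf dimH; lia.
Qed.

(** The last condition is about the whole space. The condition on F_k(oo)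
    implies the earlier ones, since intersecting with F_(i+1)(oo) instead loses
    at most k - 1 - i dimensions. *)
Lemma schubert_lambda_kn (k : nat) (H : {vspace 'rV[C]_n}) :
  (1 < k)%N -> (1 < n - k)%N ->
  schubert n (lambda_kn k n) None H <->
  Gr k n H /\ (k <= (\dim (H :&: osc_flag n None k)).+1)%N.
Proof.
move=> k_gt1 nk_gt1.
split=> [[dimH cond]|[dimH cond]]; [split=> // | split=> // i].
  have lt2k : (k - 2 < k)%N by lia.
  (* The condition on F_k(oo) is the last but one, at index k - 2 from 0. *)
  have := cond (Ordinal lt2k); rewrite /lambda_kn /=.
  have -> : ((k - 2).+1 < k)%N by lia.
  have -> : (n - k + (k - 2).+1 - (n - k - 1) = k)%N by lia.
  by lia.
have ltik := ltn_ord i.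
rewrite /lambda_kn; case: (leqP k i.+1) => [leki | ltiSk].
  have -> : (n - k + i.+1 - 0 = n)%N by lia.
  by rewrite osc_flag_full capvf dimH.
have -> : (n - k + i.+1 - (n - k - 1) = i.+2)%N by lia.
have := @dim_cap_osc_flag H None i.+2 k; lia.
Qed.

End VectorsAsPolynomials.

(** * Derivatives and the bilinear concomitant *)

Section Concomitant.
Variables (C : numFieldType) (k : nat).
Implicit Types (p h : {poly C}).

(** The bilinear concomitant of the operator p |-> p^(k), as in Lagrange's
    identity. Its value at t involves p only through the Taylor coefficients of
    index less than k at t, so it vanishes if p vanishes at t to order k. *)
Definition concomitant p h : {poly C} :=
  \sum_(i < k) (-1) ^+ i *: (p^`(i) * h^`(k - i.+1)).

Lemma concomitantDl a p q h :
  concomitant (a *: p + q) h = a *: concomitant p h + concomitant q h.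
Proof.
rewrite /concomitant scaler_sumr -big_split; apply: eq_bigr => i _ /=.
by rewrite derivnD derivnZ mulrDl scalerDr -scalerAl !scalerA mulrC.
Qed.

Lemma concomitantDr a p h g :
  concomitant p (a *: h + g) = a *: concomitant p h + concomitant p g.
Proof.
rewrite /concomitant scaler_sumr -big_split; apply: eq_bigr => i _ /=.
by rewrite derivnD derivnZ mulrDr scalerDr -scalerAr !scalerA mulrC.
Qed.

Lemma concomitantZr a p h : concomitant p (a *: h) = a *: concomitant p h.
Proof.
rewrite /concomitant scaler_sumr; apply: eq_bigr => i _ /=.
by rewrite derivnZ -scalerAr !scalerA mulrC.
Qed.

(** Lagrange's identity: the sum of the derivatives telescopes. *)
Lemma deriv_concomitant p h :
  (concomitant p h)^`() = p * h^`(k) - (-1) ^+ k *: (p^`(k) * h).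
Proof.
pose T i : {poly C} := - ((-1) ^+ i *: (p^`(i) * h^`(k - i))).
have -> : p * h^`(k) - (-1) ^+ k *: (p^`(k) * h) = T k - T 0.
  by rewrite /T subn0 subnn expr0 scale1r opprK addrC.
rewrite -(telescope_sumr T (leq0n k)) big_mkord /concomitant raddf_sum /=.
apply: eq_bigr => i _; rewrite derivZ derivM -derivnS -derivnS.
rewrite -subSn ?subSS; last exact: ltn_ord.
rewrite /T opprK addrC exprS mulN1r scaleNr opprK scalerDr.
by rewrite addrC.
Qed.

Lemma derivn_size_eq0 p m : (size p <= m)%N -> p^`(m) = 0.
Proof.
move=> lepm; apply/polyP => i; rewrite coef_derivn coef0 nth_default ?mul0rn //.
by rewrite (leq_trans lepm) // leq_addr.
Qed.

Lemma concomitant0l h : concomitant 0 h = 0.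
Proof.
rewrite /concomitant big1 // => i _.
by rewrite [0^`(i)](derivn_size_eq0 (m := i)) ?size_poly0 // mul0r scaler0.
Qed.

Lemma size_derivn_leq p m : (size p^`(m) <= size p - m)%N.
Proof.
apply/leq_sizeP => i lei; rewrite coef_derivn nth_default ?mul0rn //.
by rewrite -leq_subLR.
Qed.

(** Characteristic zero: differentiation kills constants only. *)
Lemma leq_size_deriv p : (size p <= (size p^`()).+1)%N.
Proof.
apply/leq_sizeP => -[|i] // lti; apply/eqP.
have : (p^`())`_i == 0 by rewrite nth_default.
by rewrite coef_deriv mulrn_eq0.
Qed.

Lemma deriv_concomitant_small p h : (size h <= k)%N ->
  (concomitant p h)^`() = - (-1) ^+ k *: (p^`(k) * h).
Proof.
by move=> szh; rewrite deriv_concomitant (derivn_size_eq0 szh) mulr0 sub0r scaleNr.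
Qed.

Lemma concomitant_const p h : (size p <= k)%N -> (size h <= k)%N ->
  concomitant p h = ((concomitant p h)`_0)%:P.
Proof.
move=> szp szh; apply: size1_polyC; apply: leq_trans (leq_size_deriv _) _.
rewrite deriv_concomitant_small // (derivn_size_eq0 szp) mul0r scaler0.
by rewrite size_poly0.
Qed.

Lemma size_concomitant n p h :
  (k < n)%N -> (size p <= n)%N -> (size h <= k)%N ->
  (size (concomitant p h) <= n)%N.
Proof.
move=> ltkn szp szh; apply: leq_trans (leq_size_deriv _) _.
rewrite deriv_concomitant_small //.
apply: (@leq_ltn_trans (size (p^`(k) * h))); first exact: size_scale_leq.
apply: leq_ltn_trans (size_polyMleq _ _) _.
have := size_derivn_leq p k; lia.
Qed.

Lemma dvdp_derivn p t i m : ('X - t%:P) ^+ m %| p ->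
  ('X - t%:P) ^+ (m - i) %| p^`(i).
Proof.
move=> dvp; elim: i => [|i IHi]; first by rewrite subn0.
rewrite derivnS subnS; case: (m - i)%N IHi => [|e]; first by rewrite /= expr0 !dvd1p.
case/dvdpP=> q ->; rewrite derivM deriv_exp derivXsubC mul1r /=.
apply: dvdp_add; apply: dvdp_mull; first exact: dvdp_exp2l.
by rewrite -mulr_natl; apply: dvdp_mull.
Qed.

(** Each term has a factor p^(i) with i < k, which still vanishes at t. *)
Lemma concomitant_dvd_root p h t : ('X - t%:P) ^+ k %| p ->
  (concomitant p h).[t] = 0.
Proof.
move=> dvp; rewrite /concomitant horner_sum big1 // => i _.
rewrite hornerZ hornerM.
have /dvdpP[r ->] : 'X - t%:P %| p^`(i).
  apply: dvdp_trans (dvdp_derivn i dvp); rewrite -{1}['X - _]expr1.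
  by rewrite dvdp_exp2l // subn_gt0.
by rewrite hornerM hornerXsubC subrr mulr0 mul0r mulr0.
Qed.

End Concomitant.

Section Antiderivatives.
Variable C : numFieldType.
Implicit Types p g : {poly C}.

(** The k-fold antiderivative without terms of degree less than k. For i < k
    the denominator i ^_ k is 0, and so is the coefficient, division by zero
    being zero. *)
Lemma antiderivn k g :
  exists2 G : {poly C}, G^`(k) = g & (size G <= k + size g)%N.
Proof.
exists (\poly_(i < k + size g) (g`_(i - k) / (i ^_ k)%:R)); last exact: size_poly.
apply/polyP => i; rewrite coef_derivn coef_poly ltn_add2l addKn.
case: ltnP => [_|lei]; last by rewrite mul0rn nth_default.
by rewrite -[LHS]mulr_natr divfK // pnatr_eq0 -lt0n ffact_gt0 leq_addr.
Qed.

Lemma derivn_eq0_size k p : p^`(k) = 0 -> (size p <= k)%N.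
Proof.
move=> p0; apply/leq_sizeP => i leki; apply/eqP.
have := congr1 (fun q : {poly C} => q`_(i - k)) p0.
rewrite coef_derivn coef0 subnKC // => /eqP; rewrite mulrn_eq0.
by case/orP=> // /eqP ff; have := ffact_gt0 i k; rewrite ff leki.
Qed.

Lemma size_deriv_pred p : size p^`() = (size p).-1.
Proof.
have [->|p0] := eqVneq p 0; first by rewrite deriv0 size_poly0.
have := lt_size_deriv p0; have := leq_size_deriv p; lia.
Qed.

End Antiderivatives.

(** * Solutions as divisors of f' *)

Section SolutionSpaces.
Variables (C : numClosedFieldType) (n k : nat) (f : {poly C}).
Hypotheses (k_gt0 : (0 < k)%N) (lt_kn : (k < n)%N).
Hypotheses (f_monic : f \is monic) (size_f : size f = n).
Implicit Types (h g : {poly C}) (v : 'rV[C]_n).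

Let conc := @concomitant C k.

(** The component of L(p_v, h) along f is read off at X^(n-1), f being monic of
    degree n - 1. What remains is linear in v and vanishes exactly when
    L(p_v, h) is a multiple of f, which presents [solspace] as a kernel. *)
Definition line_residual h v : 'rV[C]_n :=
  poly_rV (conc (vpoly v) h - (conc (vpoly v) h)`_n.-1 *: f).

Lemma line_residual_is_linear h : linear (line_residual h).
Proof.
move=> a u v; rewrite /line_residual linearP /conc concomitantDl coefD coefZ.
rewrite -linearP /=; congr poly_rV.
by rewrite scalerBr scalerA scalerDl opprD addrACA.
Qed.

HB.instance Definition _ h :=
  GRing.isLinear.Build C 'rV[C]_n 'rV[C]_n _ (line_residual h)
    (line_residual_is_linear h).

Definition solspace h : {vspace 'rV[C]_n} := lker (linfun (line_residual h)).

Lemma solspaceP h v : (size h <= k)%N ->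
  reflect (exists c, conc (vpoly v) h = c *: f) (v \in solspace h).
Proof.
move=> szh; rewrite memv_ker lfunE /=; apply: (iffP eqP) => [res0|[c Ec]].
  exists (conc (vpoly v) h)`_n.-1; apply/eqP; rewrite -subr_eq0.
  move/(congr1 rVpoly): res0; rewrite linear0 poly_rV_K => [->//|].
  rewrite (leq_trans (size_polyD _ _)) // geq_max size_polyN.
  rewrite size_concomitant ?size_vpoly //=.
  by rewrite (leq_trans (size_scale_leq _ _)) // size_f.
have f1 : f`_n.-1 = 1 by rewrite -size_f -lead_coefE; apply/eqP.
by rewrite /line_residual Ec coefZ f1 mulr1 subrr linear0.
Qed.

Lemma concomitant1 h : conc 1 h = h^`(k.-1).
Proof.
rewrite /conc /concomitant; case: k k_gt0 => // m _.
rewrite big_ord_recl /= expr0 scale1r mul1r subSS subn0 big1 ?addr0 // => i _.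
rewrite [X in X * _](_ : _ = 0) ?mul0r ?scaler0 //.
by apply: (@derivn_size_eq0 _ _ (bump 0 i)); rewrite size_poly1.
Qed.

Lemma concomitant1_const h : size h = k -> exists2 d, d != 0 & conc 1 h = d%:P.
Proof.
move=> szh; exists (conc 1 h)`_0; last first.
  by apply: concomitant_const; rewrite ?size_poly1 ?szh.
rewrite concomitant1 coef_derivn addn0 ffactnn mulrn_eq0 negb_or -lt0n fact_gt0.
by rewrite -szh -lead_coefE lead_coef_eq0 -size_poly_eq0 szh -lt0n.
Qed.

Lemma factor_sizes h g : size h = k -> f^`() = g * h ->
  size g = (n - k)%N /\ h != 0.
Proof.
move=> szh Ef'; have h0 : h != 0 by rewrite -size_poly_eq0 szh -lt0n.
have size_f' : size f^`() = n.-1 by rewrite size_deriv_pred size_f.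
split=> //; have g0 : g != 0.
  apply/eqP => g0; move: size_f'; rewrite Ef' g0 mul0r size_poly0.
  by move=> n0; move: k_gt0 lt_kn n0; lia.
move: size_f'; rewrite Ef' size_mul // szh.
by move: k_gt0 lt_kn; move: (size g) => s; lia.
Qed.

(** A k-fold antiderivative G of a suitable multiple of g satisfies
    L(G, h)' = f', so L(G, h) and f differ by a constant. That constant is
    removed by subtracting a constant from G, because L(1, h) is a nonzero
    constant. *)
Lemma solspace_top h g : size h = k -> f^`() = g * h ->
  exists v, conc (vpoly v) h = f.
Proof.
move=> szh Ef'; have [szg h0] := factor_sizes szh Ef'.
have [G Gk szG] := antiderivn k (- (-1) ^+ k *: g).
have szGn : (size G <= n)%N.
  apply: leq_trans szG _; rewrite scaleNr size_polyN.
  apply: leq_trans (leq_add (leqnn k) (size_scale_leq _ _)) _.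
  by rewrite szg subnKC // ltnW.
have [d d0 Ed] := concomitant1_const szh.
pose e := (conc G h - f)`_0.
have Ee : conc G h = f + e%:P.
  have: conc G h - f = e%:P.
    apply: size1_polyC; apply: leq_trans (leq_size_deriv _) _.
    rewrite derivB deriv_concomitant_small ?szh // Gk Ef' -scalerAl scalerA.
    by rewrite mulrNN -expr2 sqrr_sign scale1r subrr size_poly0.
  by move/eqP; rewrite subr_eq addrC => /eqP.
have [v Ev] : {v : 'rV[C]_n | vpoly v = (- (e / d)) *: 1 + G}.
  apply: vpolyP; rewrite (leq_trans (size_polyD _ _)) // geq_max szGn andbT.
  apply: leq_trans (size_scale_leq _ _) _; rewrite size_poly1.
  exact: leq_trans k_gt0 (ltnW lt_kn).
exists v; rewrite Ev /conc concomitantDl -/conc Ed Ee.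
rewrite -mul_polyC -polyCM mulNr divfK // polyCN addrC -addrA.
by rewrite subrr addr0.
Qed.

Lemma concomitant_eq0_size (p h : {poly C}) : h != 0 -> (size h <= k)%N ->
  conc p h = 0 -> (size p <= k)%N.
Proof.
move=> h0 szh pL0; apply: derivn_eq0_size.
have := deriv_concomitant_small p szh; rewrite -/(conc p h) pL0 deriv0.
move/esym/eqP; rewrite scaler_eq0 oppr_eq0 signr_eq0 mulf_eq0 (negPf h0) orbF.
by move/eqP.
Qed.

Lemma concomitant_top_size (p h : {poly C}) c :
  (size p <= k)%N -> (size h <= k)%N ->
  conc p h = c *: f -> c = 0.
Proof.
move=> szp szh E; have := concomitant_const szp szh; rewrite -/(conc p h) E.
move=> /(congr1 (fun q : {poly C} => q`_n.-1)).
rewrite coefZ coefC -size_f -lead_coefE (eqP f_monic) mulr1 => ->.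
by have -> : ((size f).-1 == 0)%N = false by rewrite size_f; lia.
Qed.

(** Adding the polynomial 1 to the solution space gives the same space of
    dimension k + 1 as adding v0, with L(p_v0, h) = f, to the polynomials of
    degree less than k. Neither of the two vectors lies in the space it is
    added to. *)
Lemma dim_solspace h g : size h = k -> f^`() = g * h -> \dim (solspace h) = k.
Proof.
move=> szh Ef'; have [szg h0] := factor_sizes szh Ef'.
have szhk : (size h <= k)%N by rewrite szh.
have [v0 Ev0] := solspace_top szh Ef'.
have [d d0 Ed] := concomitant1_const szh.
have [one Eone] : {v : 'rV[C]_n | vpoly v = 1}.
  by apply: vpolyP; rewrite size_poly1 (leq_trans k_gt0) // ltnW.
have one_notin : one \notin solspace h.
  apply/(solspaceP _ szhk) => -[c]; rewrite Eone => Ec.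
  have c0 : c = 0 by apply: concomitant_top_size Ec; rewrite ?size_poly1.
  by move/eqP: Ec; rewrite c0 scale0r Ed polyC_eq0 (negPf d0).
have v0_notin : v0 \notin osc_flag n None k.
  rewrite mem_osc_flag_inf ?(ltnW lt_kn) //; apply/negP => szv0.
  have := @concomitant_top_size _ h 1 szv0 szhk; rewrite scale1r => /(_ Ev0).
  by move/eqP; rewrite oner_eq0.
apply: succn_inj; rewrite -(dim_addv_line one_notin).
rewrite -[in RHS](@dim_osc_flag_inf C n k) ?(ltnW lt_kn) // -(dim_addv_line v0_notin).
congr (\dim _); apply/eqP; rewrite eqEsubv !subv_add -!memvE.
apply/andP; split; apply/andP; split.
- apply/subvP => v /(solspaceP _ szhk)[c Ec].
  apply/memv_addP; exists (v - c *: v0); last first.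
    by exists (c *: v0); rewrite ?subrK // memvZ // memv_line.
  rewrite mem_osc_flag_inf ?(ltnW lt_kn) //.
  apply: (concomitant_eq0_size h0 szhk); rewrite addrC -scaleNr linearP /conc.
  by rewrite concomitantDl -/conc Ev0 Ec scaleNr addNr.
- apply: (subvP (addvSl _ _)).
  by rewrite mem_osc_flag_inf ?(ltnW lt_kn) // Eone size_poly1.
- apply/subvP => w; rewrite mem_osc_flag_inf ?(ltnW lt_kn) // => szw.
  pose e := (conc (vpoly w) h)`_0.
  have Ee : conc (vpoly w) h = e%:P by apply: concomitant_const.
  apply/memv_addP; exists (w - (e / d) *: one); last first.
    by exists ((e / d) *: one); rewrite ?subrK // memvZ // memv_line.
  apply/(solspaceP _ szhk); exists 0; rewrite scale0r addrC -scaleNr linearP /conc.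
  rewrite concomitantDl -/conc /= Eone Ed Ee -mul_polyC -polyCM mulNr divfK //.
  by rewrite polyCN addNr.
- apply: (subvP (addvSl _ _)); apply/(solspaceP _ szhk).
  by exists 1; rewrite scale1r.
Qed.

(** The solution space lies in F_k(oo) + <[v0]>, where L(p_v0, h) = f. *)
Lemma solspace_cap_inf h g : size h = k -> f^`() = g * h ->
  (k <= (\dim (solspace h :&: osc_flag n None k)).+1)%N.
Proof.
move=> szh Ef'; have [szg h0] := factor_sizes szh Ef'.
have szhk : (size h <= k)%N by rewrite szh.
have [v0 Ev0] := solspace_top szh Ef'.
have dim1 : (\dim <[v0]> <= 1)%N by rewrite dim_vline leq_b1.
apply: (leq_trans _ (eq_leq (addn1 _))).
apply: leq_trans (leq_add (leqnn _) dim1).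
apply: leq_trans (dim_cap_addv _ _ _).
rewrite -[leqLHS](dim_solspace szh Ef'); apply: dimvS.
rewrite subv_cap subvv; apply/subvP => v /(solspaceP _ szhk)[c Ec].
apply/memv_addP; exists (v - c *: v0); last first.
  by exists (c *: v0); rewrite ?subrK // memvZ // memv_line.
rewrite mem_osc_flag_inf ?(ltnW lt_kn) //.
apply: (concomitant_eq0_size h0 szhk); rewrite addrC -scaleNr linearP /conc.
by rewrite concomitantDl -/conc Ev0 Ec scaleNr addNr.
Qed.

(** Start from p with L(p, h) = f and subtract its Taylor polynomial T of
    degree less than k at t, which is its remainder modulo (X - t)^k. Since
    L(T, h) is a constant, evaluating at the root t of f shows that this
    constant is 0, so the difference is still in the solution space, and it
    vanishes at t to order k. *)
Lemma solspace_meets h g t : size h = k -> f^`() = g * h -> root f t ->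
  (solspace h :&: osc_flag n (Some t) (n - k) != 0)%VS.
Proof.
move=> szh Ef' ft; have szhk : (size h <= k)%N by rewrite szh.
have [v0 Ev0] := solspace_top szh Ef'.
pose X := ('X - t%:P) ^+ k; pose T := vpoly v0 %% X.
have X0 : X != 0 by rewrite expf_neq0 // polyXsubC_eq0.
have szT : (size T <= k)%N.
  by have := ltn_modp (vpoly v0) X; rewrite X0 size_exp_XsubC ltnS.
have XT : X %| vpoly v0 - T by rewrite /T {1}(divp_eq (vpoly v0) X) addrK dvdp_mull.
have [w Ew] : {w : 'rV[C]_n | vpoly w = - 1 *: T + vpoly v0}.
  apply: vpolyP; rewrite scaleN1r (leq_trans (size_polyD _ _)) // geq_max.
  by rewrite size_polyN size_vpoly (leq_trans szT) // ltnW.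
rewrite scaleN1r addrC in Ew.
have EL : conc (vpoly w) h = f - ((conc T h)`_0)%:P.
  rewrite Ew addrC -scaleN1r /conc concomitantDl -/conc Ev0 scaleN1r addrC.
  by rewrite [conc T h]concomitant_const // coefC.
have e0 : (conc T h)`_0 = 0.
  have := concomitant_dvd_root h XT.
  rewrite -Ew -/(conc _ _) EL hornerD hornerN hornerC (eqP ft).
  by rewrite sub0r => /eqP; rewrite oppr_eq0 => /eqP.
rewrite e0 subr0 in EL.
have w0 : w != 0.
  apply: contraTneq (monic_neq0 f_monic) => w0; rewrite negbK -EL w0 linear0.
  by rewrite /conc concomitant0l.
apply/eqP => cap0; case/negP: w0.
rewrite -memv0 -cap0; apply/memv_capP; split.
  by apply/(solspaceP _ szhk); exists 1; rewrite scale1r.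
rewrite mem_osc_flag_fin ?leq_subr // subKn ?(ltnW lt_kn) //.
by rewrite Ew.
Qed.

(** If L(p, h) = f then L(p, h') = c f, and differentiation gives
    p^(k) h' = c p^(k) h. *)
Lemma solspace_sub_inj h h' g : size h = k -> f^`() = g * h ->
  h \is monic -> h' \is monic -> (size h' <= k)%N ->
  (solspace h <= solspace h')%VS -> h = h'.
Proof.
move=> szh Ef' hm h'm szh' sub.
have szhk : (size h <= k)%N by rewrite szh.
have [v0 Ev0] := solspace_top szh Ef'.
have /(subvP sub) : v0 \in solspace h.
  by apply/(solspaceP _ szhk); exists 1; rewrite scale1r.
move=> /(solspaceP _ szh')[c Ec].
have P0 : (vpoly v0)^`(k) != 0.
  apply/eqP => P0; have := deriv_concomitant_small (vpoly v0) szhk.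
  rewrite -/(conc _ _) Ev0 P0 mul0r scaler0 => /(congr1 (size \o val)) /=.
  rewrite size_deriv_pred size_f size_poly0.
  by move: k_gt0 lt_kn => k0 kn n0; lia.
have E : (vpoly v0)^`(k) * h' = (vpoly v0)^`(k) * (c *: h).
  apply: (scalerI (a := - (-1) ^+ k)); first by rewrite oppr_eq0 signr_eq0.
  rewrite -deriv_concomitant_small // -scalerAr scalerA mulrC -scalerA.
  by rewrite -deriv_concomitant_small // -!/(conc _ _) Ec Ev0 derivZ.
have := mulfI P0 E => Eh'.
have /eqP := h'm; rewrite Eh' lead_coefZ (eqP hm) mulr1 => c1.
by rewrite c1 scale1r.
Qed.

(** A nonzero polynomial of degree less than k is not divisible by (X - t)^k. *)
Lemma flags_transverse t v : v \in osc_flag n None k ->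
  v \in osc_flag n (Some t) (n - k) -> v = 0.
Proof.
rewrite mem_osc_flag_inf ?(ltnW lt_kn) // mem_osc_flag_fin ?leq_subr //.
rewrite subKn ?(ltnW lt_kn) // => szv dv; apply/eqP; rewrite -vpoly_eq0.
apply: contraTT szv => v0; rewrite -ltnNge.
by have := dvdp_leq v0 dv; rewrite size_exp_XsubC.
Qed.

(** On W and on the h of degree less than k, L takes constant values, so the
    requirement on h is dim W < k linear equations in k unknowns. *)
Lemma annihilator_exists (W : {vspace 'rV[C]_n}) :
  (W <= osc_flag n None k)%VS -> (\dim W < k)%N ->
  exists h, [/\ h != 0, (size h <= k)%N & {in W, forall w, conc (vpoly w) h = 0}].
Proof.
move=> sWF ltWk; pose b := vbasis W.
have szb (j : 'I_(\dim W)) : (size (vpoly (tnth b j)) <= k)%N.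
  rewrite -mem_osc_flag_inf ?(ltnW lt_kn) //; apply: (subvP sWF).
  by apply: vbasis_mem; apply: mem_tnth.
pose phi (x : 'rV[C]_k) : 'rV[C]_(\dim W) :=
  \row_j (conc (vpoly (tnth b j)) (rVpoly x))`_0.
have phi_lin : linear phi.
  move=> a x y; apply/rowP => j.
  by rewrite !mxE linearP /conc concomitantDr coefD coefZ.
pose phiL := GRing.isLinear.Build _ _ _ _ phi phi_lin.
pose phi' : {linear 'rV[C]_k -> 'rV[C]_(\dim W)} := HB.pack phi phiL.
have [|x x0 phix] := @lin_ker_neq0 _ _ _ phi'.
  by rewrite !dimvf /dim /= !mul1n.
exists (rVpoly x); split; last 1 first.
- move=> w; rewrite -(span_basis (vbasisP W)); move: w.
  apply: span_ind => [|a u w u0 w0|u].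
  + by rewrite linear0 /conc concomitant0l.
  + by rewrite linearP /= /conc concomitantDl -/conc u0 w0 scaler0 addr0.
  + case/tnthP=> j ->; rewrite [conc _ _]concomitant_const ?size_poly //.
    by have /rowP/(_ j) := phix; rewrite !mxE => ->.
- by apply: contraNneq x0 => x0; rewrite -[x]rVpolyK x0 linear0.
- exact: size_poly.
Qed.

(** Write H = W + <[v0]> with W of degree less than k, and let h annihilate W.
    For each t, the element of H vanishing at t to order k has a nonzero
    component along v0, by transversality of the flags; so L(p_v0, h) vanishes
    at t. Hence f divides L(p_v0, h), which is a nonzero multiple c f for
    degree reasons. *)
Lemma solution_is_solspace (ts : seq C) (H : {vspace 'rV[C]_n}) :
  (0 < size ts)%N -> f = \prod_(t <- ts) ('X - t%:P) -> uniq ts ->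
  \dim H = k -> (k <= (\dim (H :&: osc_flag n None k)).+1)%N ->
  {in ts, forall t, H :&: osc_flag n (Some t) (n - k) != 0}%VS ->
  exists h, [/\ h \is monic, size h = k, h %| f^`() & H = solspace h].
Proof.
move=> ts_gt0 Ef uts dimH dimW meets; set W := (H :&: _)%VS in dimW.
have ex_u t : t \in ts ->
    exists u, [/\ u != 0, u \in H & u \in osc_flag n (Some t) (n - k)].
  move/meets; set V := (_ :&: _)%VS => V0; exists (vpick V).
  by rewrite vpick0 V0; have /memv_capP[] := memv_pick V.
(* An element of H provided by one of the points t has degree at least k. *)
have [v0 v0H v0F] : exists2 v0, v0 \in H & v0 \notin osc_flag n None k.
  have [u [u0 uH uF]] := ex_u _ (mem_nth 0 ts_gt0).
  by exists u => //; apply: contra u0 => uF'; apply/eqP; apply: flags_transverse uF.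
have v0W : v0 \notin W by apply: contra v0F => /memv_capP[].
have defH : H = (W + <[v0]>)%VS.
  apply/esym/eqP; rewrite eqEdim subv_add capvSl -memvE v0H /=.
  by rewrite dim_addv_line // dimH.
have dimWk : \dim W = k.-1.
  by move: dimH; rewrite defH dim_addv_line // => <-.
have [|h [h0 szh annW]] := @annihilator_exists W (capvSr _ _).
  by rewrite dimWk prednK.
have concH w a : w \in W -> conc (vpoly (w + a *: v0)) h = a *: conc (vpoly v0) h.
  by move=> /annW w0; rewrite addrC linearP /conc concomitantDl -/conc /= w0 addr0.
(* f divides L(p_v0, h), and the degrees leave room for a constant only. *)
have [c Ec] : exists c, conc (vpoly v0) h = c *: f.
  have: f %| conc (vpoly v0) h.
    rewrite Ef; apply: uniq_roots_dvdp; last by rewrite uniq_rootsE.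
    apply/allP => t /ex_u[u [u0 uH uF]]; rewrite rootE.
    move: uH; rewrite defH => /memv_addP[w wW [_ /vlineP[a ->] Eu]].
    have a0 : a != 0.
      apply: contraNneq u0 => a0; apply/eqP; apply: flags_transverse uF.
      by rewrite Eu a0 scale0r addr0; case/memv_capP: wW.
    have := concomitant_dvd_root (k := k) (p := vpoly u) (t := t) h.
    rewrite -/(conc _ _) Eu concH // hornerZ -Eu.
    move: uF; rewrite mem_osc_flag_fin ?leq_subr // subKn ?(ltnW lt_kn) // => uF.
    by move=> /(_ uF)/eqP; rewrite mulf_eq0 (negPf a0).
  case/dvdpP=> q Eq; exists q`_0; rewrite Eq -mul_polyC; congr (_ * _).
  apply: size1_polyC; have [->|q0] := eqVneq q 0; first by rewrite size_poly0.
  have := size_concomitant lt_kn (size_vpoly v0) szh.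
  rewrite -/(conc _ _) Eq size_Mmonic // size_f.
  by move: lt_kn; move: (size q) => s; lia.
have c0 : c != 0.
  apply: contraNneq v0F => c0; rewrite mem_osc_flag_inf ?(ltnW lt_kn) //.
  by apply: (concomitant_eq0_size h0 szh); rewrite Ec c0 scale0r.
pose g := (- (-1) ^+ k / c) *: (vpoly v0)^`(k).
have Ef' : f^`() = g * h.
  have := deriv_concomitant_small (vpoly v0) szh; rewrite -/(conc _ _) Ec derivZ.
  move/(congr1 ( *:%R c^-1)); rewrite scalerA mulVf // scale1r => ->.
  by rewrite /g -scalerAl scalerA mulrC.
(* f' = g h has degree n - 2, while deg g < n - k and deg h < k. *)
have szhk : size h = k.
  have g0 : g != 0.
    apply/eqP => g0; have := congr1 (size \o val) Ef'.
    rewrite /= size_deriv_pred size_f g0 mul0r size_poly0.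
    by move: k_gt0 lt_kn => k0 kn n0; lia.
  have := congr1 (size \o val) Ef'; rewrite /= size_deriv_pred size_f size_mul //.
  have szg : (size g <= n - k)%N.
    apply: leq_trans (size_scale_leq _ _) _; apply: leq_trans (size_derivn_leq _ _) _.
    by rewrite leq_sub2r // size_vpoly.
  by move: szg szh lt_kn k_gt0; move: (size g) (size h) => s1 s2; lia.
pose h1 := (lead_coef h)^-1 *: h.
have lh : lead_coef h != 0 by rewrite lead_coef_eq0.
have szh1 : size h1 = k by rewrite size_scale // invr_eq0.
have Ef'1 : f^`() = (lead_coef h *: g) * h1.
  by rewrite /h1 -scalerAl -scalerAr scalerA divff // scale1r.
exists h1; split=> //.
- by rewrite /h1 monicE lead_coefZ mulVf.
- by rewrite Ef'1 dvdp_mull.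
apply/eqP; rewrite eqEdim dimH (dim_solspace szh1 Ef'1) leqnn andbT.
apply/subvP => v; rewrite defH => /memv_addP[w wW [_ /vlineP[a ->] ->]].
apply/solspaceP; rewrite ?szh1 //; exists ((lead_coef h)^-1 * (a * c)).
rewrite /h1 /conc concomitantZr -/conc.
by rewrite concH // Ec !scalerA !mulrA.
Qed.

(** * Real solutions *)

Lemma conjC_mxK : involutive (map_mx Num.conj : 'rV[C]_n -> 'rV[C]_n).
Proof. by move=> v; apply/rowP => j; rewrite !mxE conjCK. Qed.

Lemma concomitant_conj p h :
  conc (map_poly Num.conj p) (map_poly Num.conj h) = map_poly Num.conj (conc p h).
Proof.
rewrite /conc /concomitant rmorph_sum; apply: eq_bigr => i _ /=.
by rewrite !derivn_map map_polyZ rmorphM rmorphXn rmorphN rmorph1.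
Qed.

Hypothesis f_real : map_poly Num.conj f = f.

Lemma solspace_conj h v : (size h <= k)%N -> v \in solspace h ->
  map_mx Num.conj v \in solspace (map_poly Num.conj h).
Proof.
move=> szh /(solspaceP _ szh)[c Ec].
apply/solspaceP; first by rewrite size_map_poly.
by exists c^*; rewrite vpoly_conj concomitant_conj Ec map_polyZ f_real.
Qed.

(** Conjugation maps the solution space of h to that of its conjugate, and
    distinct monic divisors have distinct solution spaces. *)
Lemma real_solspace h : h \is monic -> size h = k -> h %| f^`() ->
  real_subspace (solspace h) <-> map_poly Num.conj h = h.
Proof.
move=> hm szh /dvdpP[g Ef']; have szhk : (size h <= k)%N by rewrite szh.
split=> [realH | Eh].
  apply/esym; apply: (solspace_sub_inj szh Ef') => //.
  - by rewrite map_monic.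
  - by rewrite size_map_poly.
  apply/subvP => v vH.
  have : [set` solspace h] v by [].
  rewrite -realH => -[u uH <-]; exact: solspace_conj.
apply/seteqP; split=> v /=.
  by case=> u uH <-; rewrite -[in solspace _]Eh; apply: solspace_conj.
move=> vH; exists (map_mx Num.conj v); last exact: conjC_mxK.
by rewrite /= -[in solspace _]Eh; apply: solspace_conj.
Qed.

Lemma real_solutionsP (ts : seq C) (H : {vspace 'rV[C]_n}) :
  (1 < k)%N -> (1 < n - k)%N ->
  f = \prod_(t <- ts) ('X - t%:P) -> uniq ts ->
  (osc_instance k n ts H /\ real_subspace H) <->
  exists h, [/\ h \is monic, size h = k, h %| f^`(),
                map_poly Num.conj h = h & H = solspace h].
Proof.
move=> k_gt1 nk_gt1 Ef uts.
have k0n : (0 < k < n)%N by rewrite k_gt0.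
have ts_gt0 : (0 < size ts)%N.
  have := size_f; rewrite Ef size_prod_XsubC.
  by move: k_gt0 lt_kn; move: (size ts) => s; lia.
split=> [[[boxes lam] realH] | [h [hm szh hf' hreal ->]]].
  have [dimH dimW] := (schubert_lambda_kn H k_gt1 nk_gt1).1 lam.
  have [h [hm szh hf' EH]] := solution_is_solspace ts_gt0 Ef uts dimH dimW
    (fun t tts => ((schubert_box t H k0n).1 (boxes t tts)).2).
  by exists h; split=> //; apply/(real_solspace hm szh hf'); rewrite -EH.
split; last by apply/real_solspace.
have [g Ef'] := dvdpP _ _ hf'; split=> [t tts|].
  apply/(schubert_box t _ k0n); split; first exact: dim_solspace szh Ef'.
  by apply: solspace_meets szh Ef' _; rewrite Ef root_prod_XsubC.
apply/schubert_lambda_kn => //; split; first exact: dim_solspace szh Ef'.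
exact: solspace_cap_inf szh Ef'.
Qed.

End SolutionSpaces.

(** * Counting real divisors *)

(** Expanding the product over j of (y^(w j) + x^(w j)) over the subsets B of J
    contributes x^a y^b for B, where b is the total weight of B. As a+b = n-2,
    the exponent of y alone selects the subset. *)
Lemma nu_subsets (J : finType) (w : J -> nat) (k n r : nat) :
  (2 <= k)%N -> (2 <= n - k)%N ->
  (forall j, w j = 1%N \/ w j = 2%N) -> #|[pred j | w j == 1%N]| = r ->
  (\sum_j w j = n - 2)%N ->
  nu k n r = #|[set B : {set J} | (\sum_(j in B) w j == k - 1)%N]%SET|.
Proof.
move=> k2 nk2 w12 Er Ew.
pose x : {poly {poly nat}} := 'X%:P; pose y : {poly {poly nat}} := 'X.
have Ec : ((n - 2 - r)./2 = #|[pred j | w j != 1%N]|)%N.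
  have -> : (n - 2 = r + #|[pred j | w j != 1%N]|.*2)%N.
    rewrite -Ew (bigID (fun j => w j == 1%N)) /= -Er -sum1_card -muln2 -sum_nat_const.
    congr (_ + _)%N; apply: eq_bigr => j; case: (w12 j) => // E;
      by rewrite ?inE E.
  by rewrite addKn doubleK.
have -> : nu k n r = ((\prod_j (y ^+ w j + x ^+ w j))`_(k - 1))`_(n - k - 1).
  rewrite /nu Ec -Er -!prodr_const.
  rewrite [in RHS](bigID (fun j => w j == 1%N)) /=.
  have -> : \prod_(j | w j == 1%N) (y ^+ w j + x ^+ w j) =
      \prod_(j | w j == 1%N) (x + y).
    by apply: eq_bigr => j /eqP->; rewrite !expr1 addrC.
  have -> // : \prod_(j | w j != 1%N) (y ^+ w j + x ^+ w j) =
      \prod_(j | w j != 1%N) (x ^+ 2 + y ^+ 2).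
  by apply: eq_bigr => j; case: (w12 j) => -> // _; rewrite addrC.
rewrite bigA_distr /= !coef_sum -sum1dep_card [RHS]big_mkcond /=.
apply: eq_bigr => B _; rewrite big_if /= !prodrXr /x /y.
have := Ew; rewrite (bigID (mem B)) /=.
set b := (\sum_(j in B) w j)%N; set a := (\sum_(j | j \notin B) w j)%N => Eab.
rewrite -rmorphXn coefMC coefXn eq_sym; case: eqP => [Eb|_].
  rewrite mul1r coefXn; suff -> : (n - k - 1 == a)%N by [].
  by apply/eqP; move: k2 nk2 Eab Eb; lia.
by rewrite mul0r coef0.
Qed.

Section RealDivisors.
Variable C : numClosedFieldType.
Implicit Types (z : C) (s : seq C) (h : {poly C}).

(** The minimal monic real polynomial with root z. *)
Definition real_factor z : {poly C} :=
  ('X - z%:P) * (if z \is Num.real then 1 else 'X - (z^*)%:P).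

Definition real_factor_deg z : nat := if z \is Num.real then 1%N else 2%N.

Lemma monic_real_factor z : real_factor z \is monic.
Proof.
by rewrite /real_factor; case: ifP => _; rewrite monicMl ?monic1 ?monicXsubC.
Qed.

Lemma size_real_factor z : size (real_factor z) = (real_factor_deg z).+1.
Proof.
rewrite /real_factor /real_factor_deg; case: ifP => _.
  by rewrite mulr1 size_XsubC.
by rewrite size_Mmonic ?monicXsubC ?polyXsubC_eq0 // !size_XsubC.
Qed.

Lemma real_factor_conj z : map_poly Num.conj (real_factor z) = real_factor z.
Proof.
rewrite /real_factor rmorphM /= map_polyXsubC; case: ifP => [zR|_].
  by rewrite rmorph1 /= (CrealP zR).
by rewrite map_polyXsubC /= conjCK mulrC.
Qed.

Lemma root_real_factor z z' : 0 <= 'Im z -> 0 <= 'Im z' ->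
  root (real_factor z) z' = (z' == z).
Proof.
move=> z_ge0 z'_ge0; rewrite /real_factor rootM root_XsubC.
case: ifPn => [_|zNR]; first by rewrite (negPf (root1 _)) orbF.
rewrite root_XsubC orbC; case: eqP => //= Ez'; case/negP: zNR.
apply/Creal_ImP/eqP; rewrite eq_le z_ge0 andbT.
by move: z'_ge0; rewrite Ez' Im_conj oppr_ge0.
Qed.

(** Roots in the open lower half-plane are the conjugates of those in the open
    upper half-plane. *)
Lemma prod_real_factor s : uniq s -> {in s, forall z, z^* \in s} ->
  \prod_(z <- s) ('X - z%:P) = \prod_(z <- s | 0 <= 'Im z) real_factor z.
Proof.
move=> us s_conj; rewrite (bigID (fun z => 0 <= 'Im z)) big_split /=.
congr (_ * _).
rewrite [RHS](eq_bigr (fun z =>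
    if z \isn't Num.real then 'X - (z^*)%:P else 1)); last first.
  by move=> z _; case: ifP.
rewrite -big_mkcondr -[LHS]big_filter -[RHS]big_filter.
rewrite -[RHS](big_map Num.conj xpredT (fun z => 'X - z%:P)).
apply: perm_big; apply: uniq_perm; rewrite ?filter_uniq //.
  by rewrite map_inj_uniq ?filter_uniq //; apply: can_inj (@conjCK C).
move=> z; rewrite mem_filter -real_ltNge ?real0 ?Creal_Im //.
apply/andP/mapP => [[z_lt0 zs]|[u]].
  exists z^*; last by rewrite conjCK.
  rewrite mem_filter s_conj // andbT Im_conj oppr_ge0 (ltW z_lt0).
  rewrite CrealE conjCK eq_sym -CrealE; apply/Creal_ImP => z0.
  by move: z_lt0; rewrite z0 ltxx.
rewrite mem_filter => /andP[/andP[u_ge0 uNR] us'] ->; split; last exact: s_conj.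
rewrite Im_conj oppr_lt0 lt_neqAle u_ge0 andbT eq_sym.
by apply: contra uNR => /eqP u0; apply/Creal_ImP.
Qed.

Variable rs : seq C.
Hypotheses (uniq_rs : uniq rs) (rs_conj : {in rs, forall z, z^* \in rs}).

(** One representative of each conjugation orbit of roots. *)
Definition upper_roots := [seq z <- rs | 0 <= 'Im z].
Let J := 'I_(size upper_roots).
Let zJ (j : J) := upper_roots`_j.

Definition real_divisor (B : {set J}) : {poly C} :=
  \prod_(j in B) real_factor (zJ j).

Lemma Im_upper_roots j : 0 <= 'Im (zJ j).
Proof.
by have := mem_nth 0 (ltn_ord j); rewrite mem_filter => /andP[].
Qed.

Lemma monic_real_divisor B : real_divisor B \is monic.
Proof. by apply: monic_prod => j _; apply: monic_real_factor. Qed.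

Lemma size_real_divisor B :
  size (real_divisor B) = (\sum_(j in B) real_factor_deg (zJ j)).+1.
Proof.
suff: size (real_divisor B) = (\sum_(j in B) real_factor_deg (zJ j)).+1 /\
  real_divisor B \is monic by case.
rewrite /real_divisor; elim/big_ind2: _ => [|d p e q [Ep mp] [Eq mq]|j _].
- by rewrite size_poly1 monic1.
- by rewrite size_Mmonic ?monic_neq0 // Ep Eq monicMl // addnS.
- by rewrite size_real_factor monic_real_factor.
Qed.

Lemma real_divisor_conj B : map_poly Num.conj (real_divisor B) = real_divisor B.
Proof.
by rewrite /real_divisor rmorph_prod; apply: eq_bigr => j _; apply: real_factor_conj.
Qed.

Lemma root_real_divisor B j : root (real_divisor B) (zJ j) = (j \in B).
Proof.
rewrite /real_divisor; apply/idP/idP => [|jB].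
  rewrite /root horner_prod => /prodf_eq0[i iB].
  rewrite -/(root _ _) root_real_factor ?Im_upper_roots //.
  by rewrite /zJ nth_uniq ?filter_uniq // => /eqP/val_inj->.
by rewrite (bigD1 j) //= rootM root_real_factor ?Im_upper_roots ?eqxx.
Qed.

Lemma real_divisor_inj : injective real_divisor.
Proof. by move=> A B E; apply/setP => j; rewrite -!root_real_divisor E. Qed.

Lemma real_divisor_full :
  real_divisor [set: J]%SET = \prod_(z <- rs) ('X - z%:P).
Proof.
rewrite prod_real_factor // -big_filter (big_nth 0) big_mkord.
by apply: eq_bigl => j; rewrite inE.
Qed.

Lemma real_divisor_dvdp B : real_divisor B %| \prod_(z <- rs) ('X - z%:P).
Proof.
rewrite -real_divisor_full [real_divisor [set: J]%SET](bigID (mem B)) /=.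
apply: dvdp_mulr; rewrite (eq_bigl (mem B)) ?dvdpp // => j.
by rewrite inE.
Qed.

(** A monic divisor is the product of X - z over its own roots, and the roots
    of a real polynomial are stable under conjugation. *)
Lemma real_divisorP h : h \is monic -> h %| \prod_(z <- rs) ('X - z%:P) ->
  map_poly Num.conj h = h -> exists B, h = real_divisor B.
Proof.
move=> hm /dvdp_prod_XsubC[m]; set s := mask m rs => h_eqp h_real.
have Eh : h = \prod_(z <- s) ('X - z%:P).
  by apply/eqP; rewrite -eqp_monic // monic_prod_XsubC.
have us : uniq s by apply: mask_uniq.
have root_s z : (z \in s) = root h z by rewrite Eh root_prod_XsubC.
have s_conj : {in s, forall z, z^* \in s}.
  move=> z; rewrite !root_s => hz; rewrite -h_real /root horner_map /=.
  by rewrite (eqP hz) conjC0.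
exists [set j | root h (zJ j)]%SET.
rewrite {1}Eh prod_real_factor // -big_filter /real_divisor.
rewrite (eq_bigl (fun j => root h (zJ j))); last by move=> j; rewrite inE.
rewrite -(big_mkord (fun j => root h upper_roots`_j)
                    (fun j => real_factor upper_roots`_j)).
rewrite -(big_nth 0 (fun z => root h z)) -[RHS]big_filter.
apply: perm_big; apply: uniq_perm; rewrite ?filter_uniq // => z.
rewrite !mem_filter root_s; case hz: (root h z) => /=; last by rewrite andbF.
rewrite andbT; suff -> : z \in rs by rewrite andbT.
by apply: (mem_mask (m := m)); rewrite root_s.
Qed.

Lemma count_real_upper :
  #|[pred j | real_factor_deg (zJ j) == 1%N]| =
  count (fun z => z \is Num.real) rs.
Proof.
rewrite -sum1_card (eq_bigl (fun j => zJ j \is Num.real)); last first.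
  by move=> j; rewrite inE /real_factor_deg; case: (_ \is _).
rewrite -(big_mkord (fun j => upper_roots`_j \is Num.real) (fun=> 1%N)).
rewrite -(big_nth 0 (fun z => z \is Num.real) (fun=> 1%N)) sum1_count count_filter.
apply: eq_count => z /=; case zR: (z \is Num.real) => //=.
by move/Creal_ImP: zR => ->; rewrite lexx.
Qed.

Lemma sum_real_factor_deg : (\sum_j real_factor_deg (zJ j) = size rs)%N.
Proof.
have := size_real_divisor [set: J]%SET; rewrite real_divisor_full size_prod_XsubC.
by case=> ->; apply: eq_bigl => j; rewrite inE.
Qed.

End RealDivisors.

(** * The number of real solutions *)

Lemma card_seq (T : eqType) (s : seq T) : uniq s -> [set` s] #= `I_(size s).
Proof.
move=> us; case Es: s => [|x0 s0]; first by rewrite set_nil II0 card_eq00.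
rewrite -{}Es {s0}.
have -> : [set` s] = nth x0 s @` `I_(size s).
  apply/seteqP; split=> x /=.
    by move=> xs; exists (index x s); [rewrite /= index_mem | exact: nth_index].
  by case=> i /= lti <-; apply: mem_nth.
apply: inj_card_eq => i j; rewrite !inE => lti ltj.
by move/eqP; rewrite nth_uniq // => /eqP.
Qed.

Theorem corollary8 (R : realType) (k n : nat) (ts : (n - 1).-tuple R[i])
    (rbox r : nat) :
  let f : {poly R[i]} := \prod_(t <- ts) ('X - t%:P) in
  (2 <= k)%N -> (2 <= n - k)%N ->
  uniq ts ->
  (forall t : R[i], t \in ts -> t^* \in ts) ->
  count (fun t : R[i] => t \is Num.real) ts = rbox ->
  separable_poly f^`() ->
  [set z : R[i] | root f^`() z /\ z \is Num.real] #= `I_r ->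
  [set H : {vspace 'rV[R[i]]_n} | osc_instance k n ts H /\ real_subspace H]
    #= `I_(nu k n r).
Proof.
move=> f k2 nk2 uts ts_conj _ sep_f' card_r.
have k_gt0 : (0 < k)%N by lia.
have lt_kn : (k < n)%N by lia.
have f_monic : f \is monic by apply: monic_prod_XsubC.
have size_f : size f = n by rewrite size_prod_XsubC size_tuple; lia.
have f_real : map_poly Num.conj f = f.
  rewrite /f (prod_real_factor uts ts_conj) rmorph_prod /=.
  by apply: eq_bigr => z _; apply: real_factor_conj.
have [rs Ef'] := closed_field_poly_normal f^`().
set D := \prod_(z <- rs) _ in Ef'.
have f'0 : f^`() != 0 by rewrite -size_poly_eq0 size_deriv_pred size_f; lia.
have lf'0 : lead_coef f^`() != 0 by rewrite lead_coef_eq0.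
have f'D : f^`() %= D by rewrite Ef' eqp_scale.
have uniq_rs : uniq rs by rewrite -separable_prod_XsubC -/D -(eqp_separable f'D).
have root_rs z : (z \in rs) = root f^`() z.
  by rewrite (eqp_root f'D) root_prod_XsubC.
have rs_conj : {in rs, forall z, z^* \in rs}.
  move=> z; rewrite !root_rs -{2}f_real deriv_map /root horner_map /= => /eqP->.
  by rewrite conjC0.
have size_rs : size rs = (n - 2)%N.
  have := eqp_size f'D; rewrite size_prod_XsubC size_deriv_pred size_f; lia.
have Er : count (fun z => z \is Num.real) rs = r.
  rewrite -size_filter; apply/card_eq_II/card_esym.
  apply: (card_eq_trans (card_esym card_r)).
  have -> : [set z | root f^`() z /\ z \is Num.real] =
      [set` [seq z <- rs | z \is Num.real]].
    apply/seteqP; split=> z /=; rewrite mem_filter root_rs.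
      by case=> -> ->.
    by case/andP.
  by apply: card_seq; rewrite filter_uniq.
have deg12 (j : 'I_(size (upper_roots rs))) :
    real_factor_deg (upper_roots rs)`_j = 1%N \/
    real_factor_deg (upper_roots rs)`_j = 2%N.
  by rewrite /real_factor_deg; case: ifP; [left | right].
have Er' := etrans (count_real_upper rs) Er.
have Ew := etrans (sum_real_factor_deg uniq_rs rs_conj) size_rs.
rewrite (nu_subsets k2 nk2 deg12 Er' Ew).
set Bs := [set B | _]%SET.
pose sol := solspace n k f.
pose div := @real_divisor _ rs.
have div_dvd B : div B %| f^`() by rewrite (eqp_dvdr _ f'D) real_divisor_dvdp.
have size_div B : B \in Bs -> size (div B) = k.
  by rewrite inE size_real_divisor => /eqP ->; lia.
have -> : [set H | osc_instance k n ts H /\ real_subspace H] =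
    [set` [seq sol (div B) | B <- enum Bs]].
  apply/seteqP; split=> H /=.
    move/(real_solutionsP k_gt0 lt_kn f_monic size_f f_real H k2 nk2 erefl uts).
    case=> h [hm szh hf' h_real ->].
    have [|B EB] := real_divisorP uniq_rs hm _ h_real.
      by rewrite -(eqp_dvdr _ f'D).
    apply/mapP; exists B; rewrite ?EB // mem_enum inE.
    by move: szh; rewrite EB size_real_divisor => <-; rewrite subn1.
  case/mapP=> B; rewrite mem_enum => /size_div szB ->.
  apply/(real_solutionsP k_gt0 lt_kn f_monic size_f f_real _ k2 nk2 erefl uts).
  exists (div B); split=> //; first exact: monic_real_divisor.
  exact: real_divisor_conj.
have -> : #|Bs| = size [seq sol (div B) | B <- enum Bs].
  by rewrite size_map cardE.
apply: card_seq; rewrite map_inj_in_uniq ?enum_uniq // => A B.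
rewrite !mem_enum => /size_div szA /size_div szB EAB.
apply: (real_divisor_inj uniq_rs).
have [g Ef'A] := dvdpP _ _ (div_dvd A).
apply: (solspace_sub_inj k_gt0 lt_kn f_monic size_f szA Ef'A).
- exact: monic_real_divisor.
- exact: monic_real_divisor.
- by rewrite -/(div B) szB.
- by move: EAB; rewrite /sol /div => ->; rewrite subvv.
Qed.
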